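(* Let $\lambda\ge\kappa$ be infinite cardinals, let $P$ and $Q$ be partial orders such that $P$ has the $(\lambda,\kappa)$-FN, and let $i\colon P\to Q$ and $j\colon Q\to P$ be order-preserving maps such that $i\circ j=\mathrm{id}_Q$. Then $Q$ also has the $(\lambda,\kappa)$-FN. In particular, every retract (in the category of boolean algebras) of a boolean algebra with the $(\lambda,\kappa)$-FN has the $(\lambda,\kappa)$-FN.
   Context: For infinite cardinals $\lambda\ge\kappa$, a partial order $P$ has the $(\lambda,\kappa)$-FN iff there is a map $(f,g)\colon P\to[P]^{<\lambda}\times[P]^{<\kappa}$ such that for all $p\le q$ in $P$ there exist $r\in f(p)\cap g(q)$ with $p\le r\le q$ and $s\in g(p)\cap f(q)$ with $p\le s\le q$. Here $[P]^{<\mu}$ is the set of subsets of $P$ of cardinality less than $\mu$. A boolean algebra has the $(\lambda,\kappa)$-FN iff its underlying partial order does. *)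

(* Defs.v *)
From mathcomp Require Import all_boot all_order.
From mathcomp Require Import mathcomp_extra boolp classical_sets functions cardinality.

Set Implicit Arguments.
Unset Strict Implicit.
Unset Printing Implicit Defensive.

Import Order.Theory.
Local Open Scope classical_set_scope.
Local Open Scope card_scope.
Local Open Scope order_scope.

(* A cardinal is represented by an arbitrary type having that cardinality;
   this is faithful because the notions below depend only on cardinalities. *)

Definition card_lt (T U : Type) (A : set T) (B : set U) : Prop :=
  A #<= B /\ ~ (B #<= A).

(* [P]^{<L} *)
Definition subsets_lt (P L : Type) : set (set P) :=
  [set A : set P | card_lt A [set: L]].

Arguments subsets_lt : clear implicits.

(* The (L, K)-FN; the pair (f, g) : P -> [P]^{<L} x [P]^{<K} is given by its
   two components. *)
Definition FN (L K : Type) (d : Order.disp_t) (P : porderType d) : Prop :=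
  exists f g : P -> set P,
    [/\ forall p : P, subsets_lt P L (f p),
        forall p : P, subsets_lt P K (g p) &
        forall p q : P, p <= q ->
          (exists r : P, [/\ f p r, g q r & p <= r <= q]) /\
          (exists s : P, [/\ g p s, f q s & p <= s <= q])].

(* Boolean algebras are the ctbDistrLatticeType's (the one-element algebra is
   included). The library's {tblmorphism A -> B} only records preservation of
   \bot and \top, so homomorphisms of boolean algebras are spelled out here. *)
Definition ba_morphism (d d' : Order.disp_t) (A : ctbDistrLatticeType d)
    (B : ctbDistrLatticeType d') (h : A -> B) : Prop :=
  [/\ h \bot = \bot, h \top = \top,
      {morph h : x y / x `&` y},
      {morph h : x y / x `|` y} &
      {morph h : x / ~` x}].

(* B is a retract of A *)
Definition ba_retract (d d' : Order.disp_t) (A : ctbDistrLatticeType d)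
    (B : ctbDistrLatticeType d') : Prop :=
  exists (r : A -> B) (e : B -> A),
    [/\ ba_morphism r, ba_morphism e & r \o e = id].

(* Main.v *)
Require Import Defs.
From mathcomp Require Import all_boot all_order.
From mathcomp Require Import mathcomp_extra boolp classical_sets functions cardinality.

Local Open Scope classical_set_scope.
Local Open Scope card_scope.
Local Open Scope order_scope.

(** To interpolate between x ≤ y in [Q], move the pair into [P] along [j], interpolate there, and
    return along [i]; since [i \o j = id], the endpoints come back to x and y. So the images under
    [i] of f(j q) and g(j q) witness the FN of [Q], and [subsets_lt_image] keeps them small. A
    retract of boolean algebras is a special case, because homomorphisms are monotone
    ([ba_morphism_homo]). *)

Lemma subsets_lt_image (P Q L : Type) (i : P -> Q) (A : set P) :
  subsets_lt P L A -> subsets_lt Q L (i @` A).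
Proof.
move=> [leAL nleLA]; split.
  exact: card_le_trans (card_image_le i A) leAL.
move=> leLiA; apply: nleLA.
exact: card_le_trans leLiA (card_image_le i A).
Qed.

Lemma FN_order_retract (L K : Type) (d d' : Order.disp_t) (P : porderType d)
    (Q : porderType d') (i : P -> Q) (j : Q -> P) :
  FN L K P ->
  {homo i : p p' / p <= p'} -> {homo j : q q' / q <= q'} ->
  i \o j = id ->
  FN L K Q.
Proof.
move=> [f [g [fL gK fg]]] ihomo jhomo ij.
have jK x : i (j x) = x by rewrite -[i _]/((i \o j) x) ij.
exists (fun q => i @` f (j q)), (fun q => i @` g (j q)); split.
- by move=> q; apply: subsets_lt_image.
- by move=> q; apply: subsets_lt_image.
have between x y r : j x <= r <= j y -> x <= i r <= y.
  by move=> /andP[/ihomo + /ihomo]; rewrite !jK => -> ->.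
move=> x y /jhomo/fg [[r [fr gr xry]] [s [gs fs xsy]]]; split.
(* One and the same [r] lies in both f(j x) and g(j y), so [i r] lies in both images, even though
   [i] need not be injective. *)
- by exists (i r); split; [exists r | exists r | apply: between].
- by exists (i s); split; [exists s | exists s | apply: between].
Qed.

(** The order is equationally definable, x ≤ y meaning that the meet of x and y is x, and [h]
    preserves this equation. *)
Lemma ba_morphism_homo (d d' : Order.disp_t) (A : ctbDistrLatticeType d)
    (B : ctbDistrLatticeType d') (h : A -> B) :
  ba_morphism h -> {homo h : x y / x <= y}.
Proof.
move=> [_ _ hI _ _] x y /Order.MeetTheory.meet_idPl xy.
by apply/Order.MeetTheory.meet_idPl; rewrite -hI xy.
Qed.

Theorem theorem2p10 (L K : Type)
    (infL : infinite_set [set: L]) (infK : infinite_set [set: K])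
    (leKL : [set: K] #<= [set: L]) :
  (forall (d d' : Order.disp_t) (P : porderType d) (Q : porderType d')
      (i : P -> Q) (j : Q -> P),
    FN L K P ->
    {homo i : p p' / p <= p'} -> {homo j : q q' / q <= q'} ->
    i \o j = id ->
    FN L K Q) /\
  (forall (d d' : Order.disp_t) (A : ctbDistrLatticeType d)
      (B : ctbDistrLatticeType d'),
    FN L K A -> ba_retract A B -> FN L K B).
Proof.
split=> [d d' P Q i j|d d' A B FNA [r [e [/ba_morphism_homo rhomo]]]].
  exact: FN_order_retract.
move=> /ba_morphism_homo ehomo re.
exact: FN_order_retract FNA rhomo ehomo re.
Qed.
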